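(* Assume that the integers $N_1,N_2>1$ are divisible by the same prime numbers. Then $(\Sigma_{N_1}^{\mathbb{Z}},\Pi_{\alpha,N_1})$ is conjugate to $(\Sigma_{N_2}^{\mathbb{Z}},\Pi_{\alpha,N_2})$ via $\mathrm{Conj}_{N_1,N_2}$ for any $\alpha>0$ such that the maps $\Pi_{\alpha,N_1}$ and $\Pi_{\alpha,N_2}$ are defined. Additionally, $\mathrm{real}_{N_2}\circ\mathrm{Conj}_{N_1,N_2}=\mathrm{real}_{N_1}$.
   Context: **Dynamics.** A dynamical system $(X,T)$ is a compact metrizable space $X$ with a continuous $T:X\to X$. $(X,T)$ and $(Y,S)$ are conjugate via $\psi$ if $\psi:X\to Y$ is a continuous bijection with $\psi\circ T=S\circ\psi$. $\mathbb{N}=\{0,1,2,\dots\}$, $\Sigma_N=\{0,\dots,N-1\}$; $\Sigma_N^{\mathbb{Z}}$ has the prodiscrete topology. $\mathrm{real}_N(x)=\sum_{i=-\infty}^{\infty}x[-i]N^i\in[0,\infty]$ for $x\in\Sigma_N^{\mathbb{Z}}$. **Multiplication automata.** For $p$ dividing $N$ with $N=pq$, $\Pi_{p,N}:\Sigma_N^{\mathbb{Z}}\to\Sigma_N^{\mathbb{Z}}$ is $\Pi_{p,N}(x)[i]=g_{p,N}(x[i],x[i+1])$, where $g_{p,N}(a_1q+a_0,b_1q+b_0)=a_0p+b_1$ for $a_0,b_0\in\Sigma_q$, $a_1,b_1\in\Sigma_p$. These maps are bijective and commute. If $\alpha=p/q$ with $p=\prod p_i$, $q=\prod q_j$ products of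 positive divisors $p_i,q_j$ of $N$, then $\Pi_{\alpha,N}$ is the composition of the maps $\Pi_{p_i,N}$ and $\Pi_{q_j,N}^{-1}$ (independent of the decomposition). $\Pi_{\alpha,N}$ is ''defined'' exactly for such $\alpha$. **Multiplication cubes.** Vectors are ordered coordinatewise; $\mathbf{k}=(k,\dots,k)$; $e_i$ are the standard basis vectors. A prebasis of dimension $d$ is $n\in\mathbb{Z}_+^d$; put $N=\prod_i n[i]$ and $m(n,v)=\prod_{j=1}^d n[j]^{-v[j]}$ for $v\in\mathbb{Z}^d$. For $a\in\mathbb{N}$ and $\mathbf{0}\ge v_1\ge v_2$ in $\mathbb{Z}^d$, $\mathrm{base}_n(a,(v_1,v_2))[2]$ denotes the integer $a_1$ in the unique representation $a=a_0+a_1m(n,v_1)+a_2m(n,v_2)$ with $0\le a_0<m(n,v_1)$, $0\le a_1<m(n,v_2)/m(n,v_1)$, $a_2\ge0$. For $a\in\Sigma_N$, $\mathrm{cube}_n(a)$ is the function on pairs $v_1\ge v_2$ in $\{-1,0\}^d$ given by $\mathrm{cube}_n(a)[v_1,v_2]=\mathrm{base}_n(a,(v_1,v_2))[2]$. $T_n=\{\mathrm{cube}_n(a):a\in\Sigma_N\}$, $\mathrm{val}_n(t)=t[\mathbf{0},-\mathbf{1}]$ (so $\mathrm{val}_n(\mathrm{cube}_n(a))=a$). $X_n$ is the set of $f:\mathbb{Z}^d\to T_n$ such that $f[z][\mathbf{0},-\mathbf{1}+e_i]=f[z+e_i][-e_i,-\mathbf{1}]$ for all $z\in\mathbb{Z}^d$,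 $1\le i\le d$. **Labels.** For $f\in X_n$, the edge $\{z-e_i,z\}$ has label $\lambda(f,\{z-e_i,z\})=f[z][\mathbf{0},-e_i]$. If $p'-p=ae_j$ with $a=\pm1$, $(p,p')f=a\,m(n,\max\{p,p'\})\lambda(f,\{p,p'\})$. For general $p,p'\in\mathbb{Z}^d$, $(p,p')f=\sum_i(P_i,P_{i+1})f$ over any path of unit steps from $p$ to $p'$ (independent of the path), and $\lambda(f,(p,p'))=(p,p')f/m(n,p')$. **Microtile map.** For a $d\times d'$ matrix $A$ over $\mathbb{N}$, $n^A\in\mathbb{Z}_+^{d'}$ is $n^A[i]=m(n,-Ae_i)$. If every row of $A$ contains a positive integer, $\mu_{A,n}:X_{n^A}\to X_n$ is defined as follows: for $f\in X_{n^A}$, $x\in\mathbb{Z}^d$ choose $z_1\in\mathbb{Z}^{d'}$ with $v:=Az_1-x\ge\mathbf{0}$ and $z_2\le z_1$ with $Az_2\le x-\mathbf{1}$, let $a=\lambda(f,(z_2,z_1))\in\mathbb{N}$, and put $\mu_{A,n}(f)[x]=\mathrm{cube}_n(\mathrm{base}_n(a,(-v,-v-\mathbf{1}))[2])$ (independent of choices; the result is in $X_n$). **Tessellations and configurations.** $\mathrm{tess}_n:\Sigma_N^{\mathbb{Z}}\to X_n$ is $\mathrm{tess}_n(x)[z]=\mathrm{cube}_n(\Pi_{\alpha(z,n),N}(x)[0])$ with $\alpha(z,n)=\prod_i n[i]^{z[i]}$; $\mathrm{diag}_n:X_n\to\Sigma_N^{\mathbb{Z}}$ is $\mathrm{diag}_n(f)[i]=\mathrm{val}_n(f[\mathbf{i}])$.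 **The map $\mathrm{Conj}$.** For $N>1$ with prime decomposition $N=\prod_{i=1}^d p_i^{k_i}$ ($p_1<\dots<p_d$, $k_i\ge1$), let $n=(p_1^{k_1},\dots,p_d^{k_d})$, $m=(p_1,\dots,p_d)$, $M=\prod_i p_i$, and let $A_N$ be the diagonal matrix with diagonal $(k_1,\dots,k_d)$, so $n=m^{A_N}$. Then $\mathrm{Conj}_{N,M}=\mathrm{diag}_m\circ\mu_{A_N,m}\circ\mathrm{tess}_n$ (a bijection $\Sigma_N^{\mathbb{Z}}\to\Sigma_M^{\mathbb{Z}}$). If $N'>1$ is divisible by the same primes as $N$, then $\mathrm{Conj}_{N,N'}=\mathrm{Conj}_{N',M}^{-1}\circ\mathrm{Conj}_{N,M}$. *)

(* Defs.v *)
From mathcomp Require Import all_boot all_order all_algebra.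
From mathcomp Require Import all_classical all_reals all_analysis.

Set Implicit Arguments.
Unset Strict Implicit.
Unset Printing Implicit Defensive.

Import Order.TTheory GRing.Theory Num.Theory.
Import numFieldNormedType.Exports.

Local Open Scope classical_set_scope.
Local Open Scope ring_scope.

Definition metrizable (R : realType) (X : topologicalType) : Prop :=
  exists d : X -> X -> R,
    [/\ (forall x y, d x y = 0 <-> x = y),
        (forall x y, d x y = d y x),
        (forall x y z, d x z <= d x y + d y z) &
        (forall (x : X) (A : set X),
           nbhs x A <-> exists2 e, 0 < e & [set y | d x y < e] `<=` A)].

Definition dynamical_system (R : realType) (X : topologicalType)
    (T : X -> X) : Prop :=
  [/\ compact [set: X], metrizable R X & continuous T].

Definition conjugate_via (R : realType) (X Y : topologicalType)
    (T : X -> X) (S : Y -> Y) (psi : X -> Y) : Prop :=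
  [/\ dynamical_system R T, dynamical_system R S,
      continuous psi, bijective psi & psi \o T = S \o psi].

(* A classical inverse of [f]; [x0] is only returned off the range of [f]. *)
Definition inverse_fun (X : choiceType) (Y : Type) (f : X -> Y) (x0 : X)
    (y : Y) : X :=
  xget x0 [set x | f x = y].

Definition config (N : nat) : Type :=
  prod_topology (fun _ : int => discrete_topology 'I_N).

Definition symbol (N : nat) (x : config N) (i : int) : 'I_N := x i.

Definition cast_config (N N' : nat) (e : N = N') (x : config N) : config N' :=
  fun i => cast_ord e (symbol x i).

Definition real_of_config (R : realType) (N : nat) (x : config N) : \bar R :=
  \esum_(i in [set: int]) ((symbol x (- i))%:R * N%:R ^ i)%:E.

(* With q = N / p, the digits of a = a1 q + a0 and b = b1 q + b0 entering
   g_{p,N}(a, b) = a0 p + b1 are a0 = a mod q and b1 = b div q. *)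
Definition mul_rule (p N a b : nat) : nat :=
  ((a %% (N %/ p)) * p + b %/ (N %/ p))%N.

Lemma mul_rule_lt (p N a b : nat) :
  (p %| N)%N -> (b < N)%N -> (mul_rule p N a b < N)%N.
Proof.
move=> /dvdnP[q ->]; case: p => [|p]; first by rewrite muln0.
rewrite /mul_rule mulnK // => ltb.
have q0 : (0 < q)%N by case: q ltb.
have hb : (b %/ q < p.+1)%N by rewrite ltn_divLR // mulnC.
apply: (@leq_trans ((a %% q).+1 * p.+1)).
  by rewrite mulSn addnC ltn_add2r.
by rewrite leq_mul2r ltn_mod q0 orbT.
Qed.

(* By [mul_rule_lt] the default value of [insubd] is not used when p | N. *)
Definition Pi_div (p N : nat) (x : config N) : config N :=
  fun i => insubd (symbol x i) (mul_rule p N (symbol x i) (symbol x (i + 1))).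

Definition Pi_div_inv (q N : nat) (y : config N) : config N :=
  inverse_fun (@Pi_div q N) y y.

Definition Pi_decomposition (N : nat) (alpha : rat)
    (pq : seq nat * seq nat) : Prop :=
  [/\ {in pq.1, forall p, (0 < p)%N && (p %| N)%N},
      {in pq.2, forall q, (0 < q)%N && (q %| N)%N} &
      alpha = (\prod_(p <- pq.1) p)%:R / (\prod_(q <- pq.2) q)%:R].

Definition Pi_comp (N : nat) (pq : seq nat * seq nat) (x : config N) :
    config N :=
  foldr (fun p => @Pi_div p N) (foldr (fun q => @Pi_div_inv q N) x pq.2) pq.1.

Definition Pi_defined (alpha : rat) (N : nat) : Prop :=
  exists pq, Pi_decomposition N alpha pq.

(* The composition along a chosen decomposition of alpha; it does not depend on
   the choice. It is the identity when Pi_{alpha,N} is not defined. *)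
Definition Pi (alpha : rat) (N : nat) : config N -> config N :=
  Pi_comp (xget ([::], [::]) [set pq | Pi_decomposition N alpha pq]).
Arguments Pi : clear implicits.

Notation vec d := 'cV[int]_d.

Definition lev (d : nat) (u v : vec d) : bool := [forall i, u i 0 <= v i 0].

Definition evec (d : nat) (i : 'I_d) : vec d := delta_mx i 0.

Definition kvec (d : nat) (k : int) : vec d := const_mx k.
Arguments kvec {d} k.

Record prebasis (d : nat) := Prebasis {
  pb_entry :> 'I_d -> nat;
  pb_gt0 : forall i, (0 < pb_entry i)%N
}.

Definition pb_size (d : nat) (n : prebasis d) : nat := (\prod_(i < d) n i)%N.

Definition weight (d : nat) (n : prebasis d) (v : vec d) : rat :=
  \prod_(j < d) (n j)%:R ^ (- v j 0).

(* base_n(a,(v1,v2))[2] *)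
Definition base_digit2 (d : nat) (n : prebasis d) (a : nat) (v1 v2 : vec d) :
    nat :=
  xget 0%N [set a1 : nat | exists a0 a2 : nat,
    [/\ a%:R = a0%:R + a1%:R * weight n v1 + a2%:R * weight n v2,
        a0%:R < weight n v1 &
        a1%:R < weight n v2 / weight n v1]].

Definition corner (d : nat) (v : vec d) : bool :=
  [forall i, (v i 0 == -1) || (v i 0 == 0)].

(* cube_n(a) is a function on the pairs v1 >= v2 of corners; it is extended by 0
   to all pairs of vectors. *)
Definition cube_fun (d : nat) (n : prebasis d) (a : nat) (v1 v2 : vec d) : nat :=
  if [&& corner v1, corner v2 & lev v2 v1] then base_digit2 n a v1 v2 else 0%N.

Record tile (d : nat) (n : prebasis d) := Tile {
  tile_fun :> vec d -> vec d -> nat;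
  tileP : exists a : 'I_(pb_size n), tile_fun = cube_fun n a
}.

Definition cube (d : nat) (n : prebasis d) (a : 'I_(pb_size n)) : tile n :=
  Tile (ex_intro _ a erefl).

Lemma pb_size_gt0 (d : nat) (n : prebasis d) : (0 < pb_size n)%N.
Proof. by apply: prodn_gt0 => i; apply: pb_gt0. Qed.

Lemma tile_val_lt (d : nat) (n : prebasis d) (t : tile n) :
  (t 0%R (kvec (- 1)%R) < pb_size n)%N.
Proof.
have [a ->] := tileP t; rewrite /cube_fun; case: ifP => _; last exact: pb_size_gt0.
rewrite /base_digit2; case: xgetP => [y _ [a0 [a2 [_ _]]]|_]; last exact: pb_size_gt0.
have -> : weight n 0 = 1 by apply: big1 => j _; rewrite mxE oppr0 expr0z.
have -> : weight n (kvec (- 1)) = (pb_size n)%:R.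
  by rewrite natr_prod; apply: eq_bigr => j _; rewrite mxE opprK expr1z.
by rewrite divr1 ltr_nat.
Qed.

Definition val_tile (d : nat) (n : prebasis d) (t : tile n) : 'I_(pb_size n) :=
  Ordinal (tile_val_lt t).

(* X_n. The maps between the spaces X_n below are written on all of
   Z^d -> T_n; the choices made in their definitions are immaterial on X_n. *)
Definition tiling (d : nat) (n : prebasis d) : set (vec d -> tile n) :=
  [set f | forall z i,
     f z 0 (kvec (- 1) + evec i) = f (z + evec i) (- evec i) (kvec (- 1))].

(* lambda(f, {z - e_i, z}) *)
Definition edge_label (d : nat) (n : prebasis d) (f : vec d -> tile n)
    (z : vec d) (i : 'I_d) : nat :=
  f z 0 (- evec i).

(* A path is a starting point together with a list of unit steps; (i, true)
   stands for + e_i and (i, false) for - e_i. *)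
Fixpoint path_end (d : nat) (p : vec d) (s : seq ('I_d * bool)) : vec d :=
  match s with
  | [::] => p
  | (i, true) :: s' => path_end (p + evec i) s'
  | (i, false) :: s' => path_end (p - evec i) s'
  end.

(* For both signs of a step, max{p, p'} is the upper end of the edge. *)
Fixpoint path_sum (d : nat) (n : prebasis d) (f : vec d -> tile n)
    (p : vec d) (s : seq ('I_d * bool)) : rat :=
  match s with
  | [::] => 0
  | (i, true) :: s' =>
      weight n (p + evec i) * (edge_label f (p + evec i) i)%:R
      + path_sum f (p + evec i) s'
  | (i, false) :: s' =>
      - (weight n p * (edge_label f p i)%:R) + path_sum f (p - evec i) s'
  end.

(* (p, p')f *)
Definition path_diff (d : nat) (n : prebasis d) (f : vec d -> tile n)
    (p p' : vec d) : rat :=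
  xget 0 [set c | exists2 s, path_end p s = p' & c = path_sum f p s].

(* lambda(f, (p, p')) *)
Definition label (d : nat) (n : prebasis d) (f : vec d -> tile n)
    (p p' : vec d) : rat :=
  path_diff f p p' / weight n p'.

Definition mulmxv (d d' : nat) (A : 'M[nat]_(d, d')) (z : vec d') : vec d :=
  map_mx Posz A *m z.

Lemma pb_exp_gt0 (d d' : nat) (n : prebasis d) (A : 'M[nat]_(d, d'))
  (i : 'I_d') : (0 < \prod_(j < d) n j ^ A j i)%N.
Proof. by apply: prodn_gt0 => j; rewrite expn_gt0 pb_gt0. Qed.

(* n^A *)
Definition pb_exp (d d' : nat) (n : prebasis d) (A : 'M[nat]_(d, d')) :
    prebasis d' :=
  Prebasis (pb_exp_gt0 n A).

Lemma pb_expE (d d' : nat) (n : prebasis d) (A : 'M[nat]_(d, d')) (i : 'I_d') :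
  (pb_exp n A i)%:R = weight n (- mulmxv A (evec i)).
Proof.
rewrite /pb_exp /= /weight natr_prod; apply: eq_bigr => j _.
rewrite !mxE opprK (bigD1 i) //= !mxE !eqxx mulr1 big1 => [|k ki].
  by rewrite addr0 -exprnP natrX.
by rewrite !mxE (negPf ki) mulr0.
Qed.

(* The default value is not reached when every row of A has a positive entry. *)
Definition microtile (d d' : nat) (A : 'M[nat]_(d, d')) (n : prebasis d)
    (f : vec d' -> tile (pb_exp n A)) (x : vec d) : tile n :=
  cube (xget (Ordinal (pb_size_gt0 n))
    [set b | exists (z1 z2 : vec d') (a : nat),
      let v := mulmxv A z1 - x in
      [/\ lev 0 v, lev z2 z1, lev (mulmxv A z2) (x - kvec 1),
          a%:R = label f z2 z1 &
          b = base_digit2 n a (- v) (- v - kvec 1) :> nat]]).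

Definition tess_exponent (d : nat) (z : vec d) (n : prebasis d) : rat :=
  \prod_(i < d) (n i)%:R ^ z i 0.

Definition tess (d : nat) (n : prebasis d) (x : config (pb_size n)) :
    vec d -> tile n :=
  fun z => cube (symbol (Pi (tess_exponent z n) (pb_size n) x) 0).

Definition diag (d : nat) (n : prebasis d) (f : vec d -> tile n) :
    config (pb_size n) :=
  fun i => val_tile (f (kvec i)).

(* [primes N] is the increasing list of the prime divisors of N. *)
Definition nth_prime (N : nat) (i : 'I_(size (primes N))) : nat :=
  nth 0%N (primes N) i.

Lemma nth_prime_gt0 (N : nat) (i : 'I_(size (primes N))) : (0 < nth_prime i)%N.
Proof.
have : nth_prime i \in primes N by rewrite mem_nth.
by rewrite mem_primes => /and3P[/prime_gt0].
Qed.

(* m = (p_1, ..., p_d) *)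
Definition prime_pb (N : nat) : prebasis (size (primes N)) :=
  Prebasis (@nth_prime_gt0 N).

(* A_N *)
Definition mult_mx (N : nat) : 'M[nat]_(size (primes N)) :=
  diag_mx (\row_i logn (nth_prime i) N).

(* n = m^{A_N} *)
Definition primary_pb (N : nat) : prebasis (size (primes N)) :=
  pb_exp (prime_pb N) (mult_mx N).

Lemma primary_pbE (N : nat) (i : 'I_(size (primes N))) :
  primary_pb N i = (nth_prime i ^ logn (nth_prime i) N)%N.
Proof.
rewrite /primary_pb /= (bigD1 i) //= big1 ?muln1 => [|j ji].
  by rewrite !mxE eqxx mulr1n.
by rewrite !mxE (negPf ji) mulr0n expn0.
Qed.

Lemma primary_pb_size (N : nat) : (1 < N)%N -> N = pb_size (primary_pb N).
Proof.
move=> N1; rewrite {1}(prod_prime_decomp (ltnW N1)) prime_decompE big_map /=.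
rewrite (big_nth 0%N) big_mkord /pb_size.
by apply: eq_bigr => i _; rewrite primary_pbE.
Qed.

(* M *)
Definition radical (N : nat) : nat := pb_size (prime_pb N).

Definition same_primes (N N' : nat) : Prop :=
  forall p, prime p -> (p %| N)%N = (p %| N')%N.

Lemma same_primes_radical (N N' : nat) :
  (1 < N)%N -> (1 < N')%N -> same_primes N N' -> radical N = radical N'.
Proof.
move=> N1 N'1 same.
have radE K : radical K = (\prod_(p <- primes K) p)%N.
  by rewrite (big_nth 0%N) big_mkord.
rewrite !radE; congr (\prod_(p <- _) p)%N; apply/eq_primes => p.
rewrite !mem_primes (ltnW N1) (ltnW N'1) /=.
by case pp: (prime p) => //=; apply: same.
Qed.

(* Conj_{N,M} *)
Definition Conj_radical (N : nat) (hN : (1 < N)%N) (x : config N) :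
    config (radical N) :=
  diag (microtile (tess (cast_config (primary_pb_size hN) x))).

Definition zero_config (N : nat) (hN : (1 < N)%N) : config N :=
  fun _ => Ordinal (ltnW hN).

(* Conj_{N,N'} = Conj_{N',M}^{-1} o Conj_{N,M} *)
Definition Conj (N N' : nat) (hN : (1 < N)%N) (hN' : (1 < N')%N)
    (same : same_primes N N') (x : config N) : config N' :=
  inverse_fun (Conj_radical hN') (zero_config hN')
    (cast_config (same_primes_radical hN hN' same) (Conj_radical hN x)).

(* Main.v *)
Require Import Defs.
From mathcomp Require Import all_boot all_order all_algebra.
From mathcomp Require Import all_classical all_reals all_analysis.
From mathcomp Require Import zify ring.

(* A configuration with finitely many nonzero digits is the base-N expansion of a
   unique terminating rational X >= 0. Call a map between configuration spaces
   local if each output digit depends on finitely many input digits. Truncation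
   makes the terminating configurations dense, so a local map is determined by its
   action on them, and hence by the rational a if it sends every expansion of X to
   an expansion of a X. Each Pi_{alpha,N} is such a map, with a = alpha. So is base
   conversion, with a = 1: when N and N' have the same primes, the digit
   floor(X N'^i) mod N' can be read off a finite window of base-N digits of X.
   On the tessellation of an expansion of X the edge labels telescope along
   floor(X / m(z)) m(z), which identifies Conj_{N,M} with base conversion from N
   to M. Conjugacy and bijectivity then follow from uniqueness of the maps scaling
   by a given a. Finally a local map with a = 1 cannot increase real_N, since any
   window of its output comes from a terminating truncation of the input; applying
   this to the inverse as well gives equality. *)

Set Implicit Arguments.
Unset Strict Implicit.
Unset Printing Implicit Defensive.

Import Order.TTheory GRing.Theory Num.Theory.
Import numFieldNormedType.Exports.

Local Open Scope classical_set_scope.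
Local Open Scope ring_scope.

(** * Terminating expansions and local maps *)

Lemma truncn_divr (X : rat) (c : nat) :
  (0 < c)%N -> 0 <= X -> Num.truncn (X / c%:R) = (Num.truncn X %/ c)%N.
Proof.
move=> c0 X0; have cR : 0 < c%:R :> rat by rewrite ltr0n.
have /andP[l u] := truncn_itv X0; apply: truncn_def.
rewrite ler_pdivlMr // ltr_pdivrMr // -!natrM; apply/andP; split.
  by apply: le_trans l; rewrite ler_nat leq_divM.
by apply: lt_le_trans u _; rewrite ler_nat -ltn_divLR.
Qed.

Lemma config_gt0 N (x : config N) : (0 < N)%N.
Proof. by apply: leq_ltn_trans (ltn_ord (symbol x 0)). Qed.

(** Index [i] has weight N^(-i), as in [real_of_config]. The second clause says that X terminates in
    base N. *)
Definition expands N (x : config N) (X : rat) : Prop :=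
  [/\ 0 <= X, exists k : nat, X * N%:R ^+ k \is a Num.nat &
      forall i, symbol x i = (Num.truncn (X * N%:R ^ i) %% N)%N :> nat].

Lemma expands_inj N (x y : config N) X : expands x X -> expands y X -> x = y.
Proof.
by case=> _ _ hx [_ _ hy]; apply: funext => i; apply/val_inj; rewrite /= hx hy.
Qed.

Definition agree (K : nat) N (x y : config N) : Prop :=
  forall i : int, (`|i| <= K)%N -> symbol x i = symbol y i.

Lemma agreeW K L N (x y : config N) : (L <= K)%N -> agree K x y -> agree L x y.
Proof. by move=> LK h i iL; apply: h; apply: leq_trans LK. Qed.

(* The integer with base-N digits x[k-n+1], ..., x[k]. *)
Definition window N (x : config N) (k : int) (n : nat) : nat :=
  (\sum_(j < n) symbol x (k - j%:Z) * N ^ j)%N.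

Lemma windowS N (x : config N) k n :
  window x k n.+1 = (symbol x k + N * window x (k - 1) n)%N.
Proof.
rewrite /window big_ord_recl /= subr0 muln1 big_distrr /=; congr addn.
apply: eq_bigr => j _; rewrite /bump /= expnS mulnCA; congr (N * (symbol x _ * _))%N; lia.
Qed.

Lemma eq_window N (x y : config N) K (k : int) n :
  agree K x y -> (k <= K%:Z) -> (- K%:Z <= k - n%:Z + 1) ->
  window x k n = window y k n.
Proof.
move=> xy kK knK; apply: eq_bigr => j _; have := ltn_ord j => jn.
by rewrite xy //; lia.
Qed.


Lemma window_divS N (x : config N) k n :
  (window x k n.+1 %/ N)%N = window x (k - 1) n.
Proof.
have N0 := config_gt0 x.
by rewrite windowS addnC mulnC divnMDl // divn_small ?addn0.
Qed.

Lemma window_div N (x : config N) (k : int) n m : (m <= n)%N ->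
  (window x k n %/ N ^ m)%N = window x (k - m%:Z) (n - m).
Proof.
elim: m k n => [|m IH] k [|n] // mn; rewrite ?divn1 ?subr0 //.
rewrite subSS expnS divnMA window_divS IH //.
by congr window; lia.
Qed.

Lemma window_mod N (x : config N) k n :
  (window x k n.+1 %% N)%N = symbol x k.
Proof. by rewrite windowS mulnC addnC modnMDl modn_small. Qed.

Lemma natr_rat_gt0 N : (0 < N)%N -> 0 < N%:R :> rat.
Proof. by rewrite ltr0n. Qed.

(** Splitting off the last digit of floor(X N^k) leaves floor(X N^(k-1)), whence the induction on
    [n]. *)
Lemma expands_window N (x : config N) X (k : int) n : expands x X ->
  (Num.truncn (X * N%:R ^ k) %% N ^ n)%N = window x k n.
Proof.
move=> xX; have N0 := config_gt0 x; have NR := natr_rat_gt0 N0.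
case: (xX) => X0 _ dX; elim: n k => [|n IH] k.
  by rewrite modn1 /window big_ord0.
rewrite windowS dX -IH.
have -> : X * N%:R ^ (k - 1) = X * N%:R ^ k / N%:R.
  by rewrite expfzDr ?gt_eqF // mulrA.
rewrite truncn_divr ?mulr_ge0 ?exprz_ge0 ?(ltW NR) //.
set u := Num.truncn _.
rewrite modn_divl -expnSr [in LHS](divn_eq (u %% N ^ n.+1) N) addnC mulnC.
by congr addn; rewrite modn_dvdm // expnS dvdn_mulr.
Qed.

(** The value left when all digits outside [-K, K] are set to 0; the last one kept, at index K, has
    weight N^(-K). *)
Definition window_value N (K : nat) (x : config N) : rat :=
  (window x K (2 * K).+1)%:R / N%:R ^+ K.

Lemma truncation N (K : nat) (x : config N) :
  exists2 y, agree K x y & expands y (window_value K x).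
Proof.
have N0 := config_gt0 x; have NR := natr_rat_gt0 N0.
pose X := window_value K x.
pose y : config N := fun i => Ordinal (ltn_pmod (Num.truncn (X * N%:R ^ i)) N0).
exists y; last first.
  split=> //; first by rewrite /X divr_ge0 ?exprn_ge0 ?ler0n.
  by exists K; rewrite /X divfK ?expf_neq0 ?gt_eqF // natr_nat.
move=> i iK; apply/val_inj; rewrite /= /X /window_value.
have [m mE] : exists m : nat, i = K%:Z - m%:Z.
  by exists `|K%:Z - i|%N; lia.
have -> : N%:R ^ i = N%:R ^+ K / (N ^ m)%:R :> rat.
  by rewrite mE expfzDr ?gt_eqF // -exprnN natrX.
rewrite mulrA divfK ?expf_neq0 ?gt_eqF // truncn_divr ?expn_gt0 ?N0 // natrK.
rewrite window_div; last by lia.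
have -> : ((2 * K).+1 - m = (2 * K - m).+1)%N by lia.
by rewrite window_mod -mE.
Qed.

Lemma window_value_le N (x : config N) K X :
  expands x X -> window_value K x <= X.
Proof.
move=> xX; have N0 := config_gt0 x; have NR := natr_rat_gt0 N0.
rewrite ler_pdivrMr ?exprn_gt0 // -(expands_window _ _ xX).
have X0 : 0 <= X * N%:R ^ K by case: xX => X0 _ _; rewrite mulr_ge0 ?exprz_ge0 ?ler0n.
by have /andP[l _] := truncn_itv X0; apply: le_trans l; rewrite ler_nat leq_mod.
Qed.

(** This is uniform continuity: [K] may depend on [i] but not on the configurations. *)
Definition local N N' (F : config N -> config N') : Prop :=
  forall i, exists K, forall x y, agree K x y -> symbol (F x) i = symbol (F y) i.

Lemma local_agree N N' (F : config N -> config N') : local F ->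
  forall K, exists L, forall x y, agree L x y -> agree K (F x) (F y).
Proof.
move=> lF; elim=> [|K [L hL]].
  by have [L hL] := lF 0; exists L => x y /hL xy i; rewrite leqn0 absz_eq0 => /eqP->.
have [[L1 h1] [L2 h2]] := (lF K.+1%:Z, lF (- K.+1%:Z)).
exists (L + L1 + L2)%N => x y xy i; rewrite leq_eqVlt => /orP[/eqP iK|]; last first.
  by apply: hL; apply: agreeW xy; lia.
have [->|->] : i = K.+1%:Z \/ i = - K.+1%:Z by lia.
- by apply: h1; apply: agreeW xy; lia.
- by apply: h2; apply: agreeW xy; lia.
Qed.

Definition scales N N' (a : rat) (F : config N -> config N') : Prop :=
  local F /\ forall x X, expands x X -> expands (F x) (a * X).

Lemma scales_unique N N' a (F G : config N -> config N') :
  scales a F -> scales a G -> F = G.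
Proof.
move=> [lF eF] [lG eG]; apply: funext => x; apply: funext => i.
have [[K hK] [L hL]] := (lF i, lG i).
have [y xy yX] := truncation (K + L) x.
have -> : F x i = F y i by apply: hK; apply: agreeW xy; lia.
have -> : G x i = G y i by apply: hL; apply: agreeW xy; lia.
by rewrite (expands_inj (eF _ _ yX) (eG _ _ yX)).
Qed.

Lemma scales_comp N N' N'' a b (F : config N' -> config N'')
    (G : config N -> config N') :
  scales a F -> scales b G -> scales (a * b) (F \o G).
Proof.
move=> [lF eF] [lG eG]; split=> [i|x X /eG /eF]; last by rewrite mulrA.
have [K hK] := lF i; have [L hL] := local_agree lG K.
by exists L => x y /hL /hK.
Qed.

Lemma scales_id N : scales 1 (@id (config N)).
Proof. by split=> [i|x X]; [exists `|i|%N => x y; apply|rewrite mul1r]. Qed.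

Lemma scales_cast N N' (e : N = N') : scales 1 (cast_config e).
Proof.
case: N' / e; suff -> : cast_config (erefl N) = id by apply: scales_id.
by apply: funext => x; apply: funext => i; apply/val_inj.
Qed.

(** * Multiplication automata and base conversion *)

Lemma inverse_funE (X : choiceType) (Y : Type) (f : X -> Y) (g : Y -> X) x0 y :
  cancel f g -> cancel g f -> inverse_fun f x0 y = g y.
Proof. by move=> fK gK; apply: xget_unique => [|x <-]. Qed.

(** Multiplying by p is shifting by one place and dividing by q = N/p. With u = h N + l, floor(u/q)
    = h p + floor(l/q), and modulo N = q p this is (h mod q) p + floor(l/q). *)
Lemma mul_rule_digit p N u : (0 < N)%N -> (p %| N)%N ->
  mul_rule p N (u %/ N %% N) (u %% N) = (u %/ (N %/ p) %% N)%N.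
Proof.
move=> N0 /dvdnP[q qE]; have p0 : (0 < p)%N by case: p N0 qE => // N0 qE; lia.
have q0 : (0 < q)%N by case: q N0 qE => // N0 qE; lia.
subst N; rewrite /mul_rule mulnK //.
rewrite modn_dvdm ?dvdn_mulr //.
set h := (u %/ (q * p))%N; set l := (u %% (q * p))%N.
have uE : u = (h * p * q + l)%N by rewrite {1}(divn_eq u (q * p)); rewrite /h /l; lia.
rewrite {1}uE divnMDl //.
have lp : (l %/ q < p)%N by rewrite ltn_divLR // mulnC ltn_mod; lia.
have hE := divn_eq h q.
have -> : (h * p + l %/ q = h %/ q * (q * p) + (h %% q * p + l %/ q))%N.
  by rewrite {1}hE; lia.
rewrite modnMDl [RHS]modn_small //.
apply: (@leq_trans ((h %% q).+1 * p)%N); first by rewrite mulSn addnC ltn_add2r.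
by rewrite leq_mul2r ltn_mod q0 orbT.
Qed.

Lemma scales_Pi_div p N : (0 < p)%N -> (p %| N)%N -> scales p%:R (@Pi_div p N).
Proof.
move=> p0 pN; have PiE (x : config N) i :
    symbol (Pi_div p x) i = mul_rule p N (symbol x i) (symbol x (i + 1)) :> nat.
  by rewrite /symbol /Pi_div val_insubd mul_rule_lt.
split=> [i|x X [X0 [k Xk] dX]].
  exists (`|i| + 1)%N => x y xy; apply/val_inj.
  by rewrite /= !PiE !xy //; lia.
have N0 := config_gt0 x; have NR := natr_rat_gt0 N0.
split=> [||i]; first by rewrite mulr_ge0.
- by exists k; rewrite -mulrA rpredM ?natr_nat.
(* Scaling by N^(i+1) makes the digits at i and i + 1 the two lowest digits of [u]. *)
rewrite PiE !dX; set u := Num.truncn (X * N%:R ^ (i + 1)).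
have -> : X * N%:R ^ i = X * N%:R ^ (i + 1) / N%:R.
  by rewrite expfzDr ?gt_eqF // mulrA mulfK ?gt_eqF.
rewrite truncn_divr ?mulr_ge0 ?exprz_ge0 ?(ltW NR) // mul_rule_digit //.
have q0 : (0 < N %/ p)%N by rewrite divn_gt0 // dvdn_leq.
rewrite -truncn_divr ?mulr_ge0 ?exprz_ge0 ?(ltW NR) //.
congr (Num.truncn _ %% _)%N.
have qE : (N %/ p)%:R = N%:R / p%:R :> rat.
  by rewrite -{2}(divnK pN) natrM mulfK // gt_eqF ?natr_rat_gt0.
rewrite qE expfzDr ?gt_eqF //; field.
by rewrite !gt_eqF // natr_rat_gt0.
Qed.

Definition shift_right N (x : config N) : config N := fun i => symbol x (i - 1).

Lemma scales_shift_right N : (0 < N)%N -> scales N%:R^-1 (@shift_right N).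
Proof.
move=> N0; have NR := natr_rat_gt0 N0; split=> [i|x X [X0 [k Xk] dX]].
  by exists (`|i| + 1)%N => x y xy; apply: xy; lia.
split=> [||i]; first by rewrite mulr_ge0 // invr_ge0 ltW.
- by exists k.+1; rewrite exprS mulrACA mulVf ?mul1r // gt_eqF.
rewrite [symbol _ i](_ : _ = symbol x (i - 1)) // dX.
by rewrite expfzDr ?gt_eqF // mulrA mulrC mulrA.
Qed.

(** The inverse is explicit: 1/q = (N/q)/N, so it multiplies by N/q and then shifts. Both composites
    with [Pi_div] scale by 1, hence are the identity by [scales_unique]. *)
Lemma scales_Pi_div_inv q N : (0 < N)%N -> (0 < q)%N -> (q %| N)%N ->
  scales q%:R^-1 (@Pi_div_inv q N).
Proof.
move=> N0 q0 qN; have p0 : (0 < N %/ q)%N by rewrite divn_gt0 // dvdn_leq.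
have sq := scales_Pi_div q0 qN.
have sp := scales_Pi_div p0 (dvdn_div qN).
have NE : N%:R = (N %/ q)%:R * q%:R :> rat by rewrite -natrM divnK.
have [pR qR] := (natr_rat_gt0 p0, natr_rat_gt0 q0).
have pNE : N%:R^-1 * (N %/ q)%:R = q%:R^-1 :> rat.
  by rewrite NE; field; rewrite !gt_eqF.
have sg := scales_comp (scales_shift_right N0) sp; rewrite pNE in sg.
suff -> : @Pi_div_inv q N = @shift_right N \o @Pi_div (N %/ q) N by [].
have := scales_comp sg sq; have := scales_comp sq sg.
rewrite mulVf ?mulfV ?gt_eqF // => /scales_unique /(_ (@scales_id N)) e1.
move=> /scales_unique /(_ (@scales_id N)) e2.
apply: funext => y; apply: inverse_funE => x.
  exact: (congr1 (@^~ x) e2).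
exact: (congr1 (@^~ x) e1).
Qed.

Lemma scales_Pi_comp N alpha pq : (0 < N)%N ->
  Pi_decomposition N alpha pq -> scales alpha (@Pi_comp N pq).
Proof.
case: pq => ps qs N0 [/= hp hq ->].
have sG : scales (\prod_(q <- qs) q)%:R^-1
    (fun x : config N => foldr (fun q => @Pi_div_inv q N) x qs).
  elim: qs hq => [|q qs IH] hq; first by rewrite big_nil invr1; apply: scales_id.
  have /andP[q0 qN] : (0 < q)%N && (q %| N)%N by apply: hq; rewrite inE eqxx.
  rewrite big_cons natrM invfM; apply: (scales_comp (scales_Pi_div_inv N0 q0 qN)).
  by apply: IH => r rqs; apply: hq; rewrite inE rqs orbT.
elim: ps hp => [|p ps IH] hp; first by rewrite big_nil mul1r; apply: sG.
have /andP[p0 pN] : (0 < p)%N && (p %| N)%N by apply: hp; rewrite inE eqxx.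
rewrite big_cons natrM -mulrA; apply: (scales_comp (scales_Pi_div p0 pN)).
by apply: IH => r rps; apply: hp; rewrite inE rps orbT.
Qed.

(** Every decomposition yields a map scaling by [alpha], so the one picked by [xget] is
    immaterial. *)
Lemma scales_Pi N alpha : (0 < N)%N -> Pi_defined alpha N ->
  scales alpha (Pi alpha N).
Proof. by move=> N0 /(xgetPex ([::], [::])); apply: scales_Pi_comp. Qed.

(* When N' divides N^e, the window of radius e (|i| + 1) determines digit i. *)
Definition convert N N' (N'0 : (0 < N')%N) (e : nat) (x : config N) : config N' :=
  fun i => Ordinal (ltn_pmod
    (Num.truncn (window_value (e * `|i|.+1) x * N'%:R ^ i)) N'0).

(* The digit is read off [X N^K / c] with [c = N^K / N'^i] a natural number, and
   it only depends on [X N^K] modulo [c N'], which divides [N^(2K+1)]. *)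
Lemma digit_agree N N' e K (i : int) (x y : config N) X Y :
  (0 < N')%N -> (N' %| N ^ e)%N -> (e * `|i|.+1 <= K)%N -> agree K x y ->
  expands x X -> expands y Y ->
  (Num.truncn (X * N'%:R ^ i) = Num.truncn (Y * N'%:R ^ i) %[mod N'])%N.
Proof.
move=> N'0 N'N eK xy xX yY; have N0 := config_gt0 x.
have [NR N'R] := (natr_rat_gt0 N0, natr_rat_gt0 N'0).
have [c cE cN] : exists2 c : nat, N%:R ^+ K = c%:R * N'%:R ^ i :> rat &
    (c * N' %| N ^ (2 * K).+1)%N.
  have pow m : (e * m <= K)%N -> (N' ^ m %| N ^ K)%N.
    move=> emK; apply: (@dvdn_trans (N ^ (e * m))); last exact: dvdn_exp2l.
    by rewrite expnM dvdn_exp2r.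
  (* One factor N^K absorbs c when i >= 0 and the N^K inside c when i < 0; the other absorbs the
     remaining power of N'. *)
  have NK2 : (N ^ K * N ^ K %| N ^ (2 * K).+1)%N.
    by rewrite -expnD dvdn_exp2l //; lia.
  case: i eK => m /= eK.
    have mK : (N' ^ m %| N ^ K)%N by apply: pow; lia.
    exists (N ^ K %/ N' ^ m)%N; first by rewrite -exprnP -!natrX -natrM divnK.
    apply: dvdn_trans NK2; apply: dvdn_mul; first exact: dvdn_div.
    by rewrite -(expn1 N'); apply: pow; lia.
  exists (N ^ K * N' ^ m.+1)%N.
    by rewrite NegzE -exprnN natrM !natrX mulfK // expf_neq0 // gt_eqF.
  rewrite -mulnA -expnSr; apply: dvdn_trans NK2; apply: dvdn_mul => //.
  by apply: pow; lia.
have c0 : (0 < c)%N.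
  rewrite lt0n; apply/eqP => c0.
  have : N%:R ^+ K != 0 :> rat by rewrite expf_neq0 ?gt_eqF.
  by rewrite cE c0 mul0r eqxx.
have digE (z : config N) Z : expands z Z ->
    (Num.truncn (Z * N'%:R ^ i) %% N' = window z K (2 * K).+1 %% (c * N') %/ c)%N.
  move=> zZ; have Z0 : 0 <= Z by case: zZ.
  have -> : Z * N'%:R ^ i = Z * N%:R ^ K%:Z / c%:R.
    rewrite -exprnP cE; field; by rewrite gt_eqF // natr_rat_gt0.
  rewrite truncn_divr ?mulr_ge0 ?exprn_ge0 ?ler0n //.
  by rewrite modn_divl [(N' * c)%N]mulnC -(expands_window K _ zZ) modn_dvdm.
rewrite !(digE _ _ xX) !(digE _ _ yY) (eq_window xy) //; lia.
Qed.

(** The first divisibility makes the digits read off the window correct; the second makes X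
    terminate in base N'. *)
Lemma scales_convert N N' (N'0 : (0 < N')%N) e e' :
  (N' %| N ^ e)%N -> (N %| N' ^ e')%N -> scales 1 (@convert N N' N'0 e).
Proof.
move=> N'N NN'; split=> [i|x X xX].
  exists (e * `|i|.+1)%N => x y xy; apply/val_inj => /=.
  by rewrite /window_value (eq_window xy) //; lia.
rewrite mul1r; case: (xX) => X0 [k Xk] _; split=> // [|i].
  exists (e' * k)%N; have /dvdnP[c cE] : (N ^ k %| N' ^ (e' * k))%N.
    by rewrite expnM dvdn_exp2r.
  by rewrite -natrX cE mulnC natrM mulrA natrX rpredM // natr_nat.
have [y xy yY] := truncation (e * `|i|.+1) x.
by rewrite /=; apply/esym/(digit_agree N'0 N'N _ xy xX yY).
Qed.

(** * Tessellations and the microtile map *)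

Section Weights.
Variables (d : nat) (n : prebasis d).
Implicit Types u v : vec d.

Lemma pb_rat_neq0 i : (n i)%:R != 0 :> rat.
Proof. by rewrite pnatr_eq0 -lt0n pb_gt0. Qed.

Lemma weight_gt0 v : 0 < weight n v.
Proof. by apply: prodr_gt0 => i _; rewrite exprz_gt0 // ltr0n pb_gt0. Qed.

Lemma weight_neq0 v : weight n v != 0. Proof. by rewrite gt_eqF // weight_gt0. Qed.

Lemma weightD u v : weight n (u + v) = weight n u * weight n v.
Proof.
rewrite -big_split; apply: eq_bigr => i _.
by rewrite mxE opprD expfzDr // pb_rat_neq0.
Qed.

Lemma weight0 : weight n 0 = 1.
Proof. by apply: big1 => i _; rewrite mxE oppr0 expr0z. Qed.

Lemma weightN v : weight n (- v) = (weight n v)^-1.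
Proof.
apply: (mulfI (weight_neq0 v)).
by rewrite -weightD subrr weight0 mulfV // weight_neq0.
Qed.

Lemma weight_kvec k : weight n (kvec k) = (pb_size n)%:R ^ (- k).
Proof.
rewrite /weight /pb_size natr_prod.
rewrite (big_morph (fun x : rat => x ^ (- k))
  (fun x y => expfzMl x y (- k)) (exp1rz _ _)).
by apply: eq_bigr => i _; rewrite mxE.
Qed.

Lemma weight_evecN i : weight n (- evec i) = (n i)%:R.
Proof.
rewrite weightN /weight (bigD1 i) //= big1 ?mulr1 => [|j ji].
  by rewrite mxE !eqxx invr_expz opprK expr1z.
by rewrite mxE (negPf ji) expr0z.
Qed.

Definition volume v : nat := (\prod_(i < d) n i ^ `|v i 0%R|)%N.

Lemma volume_gt0 v : (0 < volume v)%N.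
Proof. by apply: prodn_gt0 => i; rewrite expn_gt0 pb_gt0. Qed.

Lemma weight_volume v : lev 0 v -> weight n (- v) = (volume v)%:R.
Proof.
move=> /forallP v0; rewrite /weight natr_prod; apply: eq_bigr => i _.
have := v0 i; rewrite !mxE opprK natrX exprnP => vi0; congr (_ ^ _).
by rewrite gez0_abs.
Qed.

Lemma tess_exponentE v : tess_exponent v n = (weight n v)^-1.
Proof. by rewrite -weightN; apply: eq_bigr => i _; rewrite mxE opprK. Qed.

(** For integral weights the unique representation is Euclidean division by c, then by e. *)
Lemma base_digit2E (a c e : nat) v1 v2 : (0 < c)%N -> (0 < e)%N ->
  weight n v1 = c%:R -> weight n v2 = (c * e)%:R ->
  base_digit2 n a v1 v2 = (a %/ c %% e)%N.
Proof.
move=> c0 e0 w1 w2; rewrite /base_digit2 w1 w2.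
have wE : (c * e)%:R / c%:R = e%:R :> rat.
  by rewrite natrM mulrC mulKf // pnatr_eq0 -lt0n.
rewrite wE; apply: xget_unique => [|a1 [a0 [a2 []]]] /=.
  exists (a %% c)%N, (a %/ c %/ e)%N; rewrite -!natrM -!natrD !ltr_nat !ltn_mod.
  split=> //; congr (_%:R).
  by rewrite {1}(divn_eq a c) {1}(divn_eq (a %/ c) e); lia.
rewrite -!natrM -!natrD !ltr_nat => /eqP; rewrite eqr_nat => /eqP -> a0c a1e.
have -> : (a0 + a1 * c + a2 * (c * e) = (a2 * e + a1) * c + a0)%N by lia.
by rewrite divnMDl // divn_small // addn0 modnMDl modn_small.
Qed.

Lemma val_cube (b : 'I_(pb_size n)) : val_tile (cube b) = b :> nat.
Proof.
rewrite /= /cube_fun ifT.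
  rewrite (base_digit2E _ (c := 1) (e := pb_size n)) ?pb_size_gt0 ?weight0 //.
    by rewrite divn1 modn_small.
  by rewrite weight_kvec mul1n.
apply/and3P; split; apply/forallP => i; rewrite !mxE ?eqxx ?orbT //.
Qed.

Lemma edge_label_cube f z i (b : 'I_(pb_size n)) :
  f z = cube b -> edge_label f z i = (b %% n i)%N.
Proof.
rewrite /edge_label => ->; rewrite /= /cube_fun ifT.
  rewrite (base_digit2E _ (c := 1) (e := n i)) ?pb_gt0 ?weight0 ?divn1 //.
  by rewrite weight_evecN mul1n.
apply/and3P; split; apply/forallP => j; rewrite !mxE ?eqxx ?orbT //;
  by case: (j == i).
Qed.

Lemma path_end_cat (p : vec d) s t :
  path_end p (s ++ t) = path_end (path_end p s) t.
Proof. by elim: s p => [|[i []] s IH] p //=. Qed.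

Lemma path_exists (p p' : vec d) : lev p p' -> exists s, path_end p s = p'.
Proof.
move=> /forallP pp'; rewrite -[p'](subrK p) addrC.
have -> : p' - p = \sum_i evec i *+ `|p' i 0%R - p i 0%R|.
  apply/colP => i; rewrite !mxE summxE (bigD1 i) //= big1 => [|j ji]; last first.
    by rewrite mulmxnE mxE eq_sym (negPf ji) mul0rn.
  by rewrite mulmxnE mxE !eqxx addr0; have := pp' i; lia.
(* Quantifying over the starting point [q] makes reachability of displacements closed under sums. *)
apply: (big_ind (fun v => forall q, exists s, path_end q s = q + v))
    => [q|u v hu hv q|i _].
- by exists [::]; rewrite addr0.
- have [s sE] := hu q; have [t tE] := hv (q + u).
  by exists (s ++ t); rewrite path_end_cat sE tE addrA.
elim: `|_|%N => [|k IH] q; first by exists [::]; rewrite mulr0n addr0.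
have [s sE] := IH (q + evec i).
by exists ((i, true) :: s); rewrite /= sE mulrS addrA.
Qed.

End Weights.

Lemma Pi_defined1 N : Pi_defined 1 N.
Proof. by exists ([::], [::]); split=> //=; rewrite !big_nil divr1. Qed.

Lemma Pi_definedM N a b : Pi_defined a N -> Pi_defined b N -> Pi_defined (a * b) N.
Proof.
move=> [[p q] [/= hp hq ->]] [[p' q'] [/= hp' hq' ->]].
exists (p ++ p', q ++ q'); split=> /= [r|r|].
- by rewrite mem_cat => /orP[/hp|/hp'].
- by rewrite mem_cat => /orP[/hq|/hq'].
- by rewrite !big_cat /= !natrM invfM mulrACA.
Qed.

Lemma Pi_definedV N a : Pi_defined a N -> Pi_defined a^-1 N.
Proof. by move=> [[p q] [/= hp hq ->]]; exists (q, p); split=> //=; rewrite invf_div. Qed.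

Lemma Pi_defined_divisor N p : (0 < p)%N -> (p %| N)%N -> Pi_defined p%:R N.
Proof.
move=> p0 pN; exists ([:: p], [::]); split=> //=; last by rewrite big_seq1 big_nil divr1.
by move=> r; rewrite inE => /eqP ->; rewrite p0.
Qed.

(** The admissible multipliers are closed under products and inverses and contain each n_i, a
    divisor of N. *)
Lemma Pi_defined_tess_exponent d (n : prebasis d) z :
  Pi_defined (tess_exponent z n) (pb_size n).
Proof.
apply: (big_ind (fun a => Pi_defined a (pb_size n))) => [||i _].
- exact: Pi_defined1.
- exact: Pi_definedM.
have h m : Pi_defined ((n i)%:R ^+ m) (pb_size n).
  elim: m => [|m IH]; first exact: Pi_defined1.
  rewrite exprS; apply: Pi_definedM IH; apply: Pi_defined_divisor; rewrite ?pb_gt0 //.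
  by rewrite /pb_size (bigD1 i) //= dvdn_mulr.
by case: (z i 0) => m; [apply: h|apply: Pi_definedV; apply: h].
Qed.

Section Tess.
Variables (d : nat) (n : prebasis d).
Local Notation N := (pb_size n).
Implicit Types (x y : config N) (z p : vec d).

Lemma scales_tess z : scales (weight n z)^-1 (Pi (tess_exponent z n) N).
Proof.
rewrite -tess_exponentE; apply: scales_Pi; first exact: pb_size_gt0.
exact: Pi_defined_tess_exponent.
Qed.

(* Rounding [X] down to a multiple of the weight of [z] gives a potential for the
   edge labels of the tessellation. *)
Definition rounding X z : rat := weight n z * (Num.truncn (X / weight n z))%:R.

Lemma truncn_weight X z v : 0 <= X -> lev 0 v ->
  Num.truncn (X / weight n (z - v)) = (Num.truncn (X / weight n z) %/ volume n v)%N.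
Proof.
move=> X0 v0; rewrite -truncn_divr ?volume_gt0 ?divr_ge0 ?(ltW (weight_gt0 _ _)) //.
by rewrite weightD weight_volume // invfM mulrA.
Qed.

Lemma lev_evec i : lev 0 (evec i : vec d).
Proof. by apply/forallP => j; rewrite !mxE; case: (_ && _). Qed.

Lemma volume_evec i : volume n (evec i) = n i.
Proof.
apply/eqP; rewrite -(eqr_nat rat) -weight_volume ?lev_evec //.
by rewrite weight_evecN.
Qed.

(** With u = floor(X / m(z)), the label is u mod n_i. Moving to z - e_i replaces u by its quotient
    by n_i in a unit n_i times larger, so exactly this remainder is lost. *)
Lemma edge_label_tess x X z i : expands x X ->
  weight n z * (edge_label (tess x) z i)%:R = rounding X z - rounding X (z - evec i).
Proof.
move=> xX; have X0 : 0 <= X by case: xX.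
have [_ /(_ _ _ xX) [_ _ /(_ 0)]] := scales_tess z.
rewrite expr0z mulr1 [_^-1 * X]mulrC => dE.
rewrite (edge_label_cube _ (b := symbol (Pi (tess_exponent z n) N x) 0)) // dE.
have nN : (n i %| N)%N by rewrite /pb_size (bigD1 i) //= dvdn_mulr.
rewrite modn_dvdm // /rounding truncn_weight ?lev_evec // volume_evec.
set u := Num.truncn _; rewrite weightD weight_evecN -mulrA -natrM -mulrBr.
congr (_ * _); rewrite {2}(divn_eq u (n i)) natrD mulnC; ring.
Qed.

Lemma path_sum_tess x X p s : expands x X ->
  path_sum (tess x) p s = rounding X (path_end p s) - rounding X p.
Proof.
move=> xX; elim: s p => [|[i b] s IH] p /=; first by rewrite subrr.
case: b; rewrite IH (edge_label_tess _ _ xX) ?addrK; ring.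
Qed.

Lemma path_sum_local p s : exists K, forall x y, agree K x y ->
  path_sum (tess x) p s = path_sum (tess y) p s.
Proof.
have edge z i : exists K, forall x y, agree K x y ->
    edge_label (tess x) z i = edge_label (tess y) z i.
  have [/(_ 0) [K hK] _] := scales_tess z; exists K => x y /hK e.
  by rewrite /edge_label /tess e.
elim: s p => [|[i b] s IH] p; first by exists 0%N.
have [K hK] := IH (if b then p + evec i else p - evec i).
have [L hL] := edge (if b then p + evec i else p) i.
exists (K + L)%N => x y xy.
have xyK : agree K x y by apply: agreeW xy; lia.
have xyL : agree L x y by apply: agreeW xy; lia.
by case: b hK hL => hK hL /=; rewrite (hK _ _ xyK) (hL _ _ xyL).
Qed.

Lemma lev_subr p p' : lev p p' -> lev 0 (p' - p).
Proof.
by move=> /forallP h; apply/forallP => i; rewrite !mxE subr_ge0.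
Qed.

(** Here [x] need not expand a rational. The path picked by [xget] reads finitely many digits, so
    its sum can be computed at any nearby expansion, where it telescopes to a difference of
    roundings. *)
Lemma label_tess x p p' : lev p p' -> exists K, forall y Y,
  agree K x y -> expands y Y ->
  label (tess x) p p' =
    (Num.truncn (Y / weight n p') %% volume n (p' - p))%:R.
Proof.
move=> pp'; rewrite /label.
have [s sE ->] : [set c | exists2 s, path_end p s = p' & c = path_sum (tess x) p s]
    (path_diff (tess x) p p').
  have [s sE] := path_exists pp'.
  by apply: xgetPex; exists (path_sum (tess x) p s), s.
have [K hK] := path_sum_local p s; exists K => y Y /hK -> yY.
have Y0 : 0 <= Y by case: yY.
rewrite (path_sum_tess _ _ yY) sE /rounding.
have pE : p = p' - (p' - p) by rewrite subKr.
rewrite {1 2}pE truncn_weight ?lev_subr // weightD weight_volume ?lev_subr //.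
set u := Num.truncn _; set c := volume n _.
rewrite -mulrA -natrM -mulrBr mulrAC mulfV ?weight_neq0 // mul1r.
rewrite {1}(divn_eq u c) natrD mulnC; ring.
Qed.

End Tess.

Section Microtile.
Variables (d d' : nat) (A : 'M[nat]_(d, d')) (n : prebasis d).

(** Both sides are the double product of n_j^(-A_ji z_i). *)
Lemma weight_pb_exp z : weight (pb_exp n A) z = weight n (mulmxv A z).
Proof.
rewrite /weight.
transitivity (\prod_(i < d') \prod_(j < d) (n j)%:R ^ (- (A j i)%:Z * z i 0) : rat).
  apply: eq_bigr => i _; rewrite /= natr_prod.
  rewrite (big_morph (fun x : rat => x ^ (- z i 0))
    (fun x y => expfzMl x y _) (exp1rz _ _)).
  by apply: eq_bigr => j _; rewrite natrX exprnP exprz_exp mulrN mulNr.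
rewrite exchange_big; apply: eq_bigr => j _ /=.
rewrite mxE -sumrN.
rewrite (big_morph (fun k : int => (n j)%:R ^ k : rat)
  (fun k l => expfzDr k l (pb_rat_neq0 n j)) (expr0z _)).
by apply: eq_bigr => i _; rewrite !mxE mulNr.
Qed.

Lemma mulmxvB z z' : mulmxv A (z - z') = mulmxv A z - mulmxv A z'.
Proof. exact: mulmxBr. Qed.

(** The label is floor(Y / m(A z1)) mod D. Dividing by the volume of v = A z1 - t turns the floor
    into floor(Y / m(t)), and reducing mod D is harmless because D is a multiple of that volume
    times [pb_size n]. *)
Lemma microtile_tess (x : config (pb_size (pb_exp n A))) (t : vec d) :
  (forall j, exists i, (0 < A j i)%N) ->
  exists K, forall y Y, agree K x y -> expands y Y ->
    val_tile (microtile (tess x) t) =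
    (Num.truncn (Y / weight n t) %% pb_size n)%N :> nat.
Proof.
move=> hA.
rewrite /microtile val_cube; set P := (X in xget _ X).
have : P (xget (Ordinal (pb_size_gt0 n)) P).
  apply: xgetPex.
  (* Since k bounds every |t_j| and the row sums of A are at least 1, A z1 >= k >= t and A z2 <= -(k
     + 1) <= t - 1 coordinatewise. *)
  pose k := (\sum_j `|t j 0%R|)%N.
  pose z1 : vec d' := kvec k%:Z; pose z2 : vec d' := kvec (- k.+1%:Z).
  have bnd j : (`|t j 0%R| <= k)%N by rewrite /k (bigD1 j) //= leq_addr.
  have Az c j : mulmxv A (kvec c) j 0 = (\sum_i A j i)%N%:Z * c.
    rewrite mxE -[Posz _]natz natr_sum mulr_suml.
    by apply: eq_bigr => i _; rewrite !mxE natz.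
  have sA j : (0 < \sum_i A j i)%N.
    by have [i Ai] := hA j; rewrite (bigD1 i) //= ltn_addr.
  have sub (u w : vec d) j : (u - w) j 0 = u j 0 - w j 0 by rewrite !mxE.
  have v0 : lev 0 (mulmxv A z1 - t).
    apply/forallP => j; rewrite mxE sub Az; have := bnd j; have := sA j; nia.
  have z21 : lev z2 z1 by apply/forallP => i; rewrite !mxE; lia.
  have lz2 : lev (mulmxv A z2) (t - kvec 1).
    apply/forallP => j; rewrite sub Az mxE; have := bnd j; have := sA j; nia.
  have [K hK] := label_tess x z21; have [y xy yY] := truncation K x.
  have := hK _ _ xy yY; set a := (_ %% _)%N => aE.
  have bM : (base_digit2 n a (- (mulmxv A z1 - t))
      (- (mulmxv A z1 - t) - kvec 1) < pb_size n)%N.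
    rewrite (base_digit2E _ (c := volume n (mulmxv A z1 - t)) (e := pb_size n)).
    - by rewrite ltn_mod pb_size_gt0.
    - exact: volume_gt0.
    - exact: pb_size_gt0.
    - by rewrite weight_volume.
    - by rewrite weightD weight_volume // weightN weight_kvec invr_expz natrM.
  by exists (Ordinal bM), z1, z2, a.
(* Only the defining properties of the chosen [z1], [z2] are used from here, so the result covers
   every admissible choice. *)
move: (xget _ P) => b [z1 [z2 [a [v0 z21 lz2 aE ->]]]].
have [K hK] := label_tess x z21; exists K => y Y xy yY.
have Y0 : 0 <= Y by case: yY.
move: aE; rewrite (hK _ _ xy yY) => /eqP; rewrite eqr_nat => /eqP ->.
set v := mulmxv A z1 - t in v0 *; set D := volume _ (z1 - z2).
rewrite (base_digit2E _ (c := volume n v) (e := pb_size n)) ?volume_gt0 ?pb_size_gt0 //.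
(* A(z1 - z2) is the sum of v, the all-ones vector and t - 1 - A z2, all nonnegative, and volumes
   multiply. *)
- have dvD : (pb_size n * volume n v %| D)%N.
    have l0 := lev_subr lz2.
    have l1 := lev_subr z21.
    suff -> : D = (volume n (t - kvec 1 - mulmxv A z2) * (pb_size n * volume n v))%N.
      by rewrite dvdn_mull.
    apply/eqP; rewrite -(eqr_nat rat) !natrM -!weight_volume //.
    have -> : (pb_size n)%:R = weight n (kvec (- 1)) by rewrite weight_kvec.
    rewrite -!weightD weight_pb_exp; apply/eqP; congr weight.
    have kE : kvec (- 1) = - kvec 1 :> vec d by apply/colP => i; rewrite !mxE.
    rewrite kE /v !opprB mulmxvB.
    by apply/colP => i; rewrite !mxE; ring.
  rewrite modn_divl modn_dvdm // -modn_divl weight_pb_exp -truncn_weight //.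
  by rewrite /v opprB addrC subrK.
- by rewrite weight_volume.
- by rewrite weightD weight_volume // weightN weight_kvec invr_expz natrM.
Qed.

End Microtile.

(** * The map Conj *)

(** The exponent N exceeds every valuation of N at a prime, so each primary factor of N divides
    M^N. *)
Lemma dvdn_exp_primes N M : (0 < N)%N ->
  (forall p, prime p -> (p %| N)%N -> (p %| M)%N) -> (N %| M ^ N)%N.
Proof.
move=> N0 NM; apply/dvdn_partP => // p; rewrite mem_primes => /and3P[pp _ pN].
rewrite p_part; apply: (@dvdn_trans (M ^ logn p N)); first by rewrite dvdn_exp2r ?NM.
by rewrite dvdn_exp2l // ltnW // ltn_logl.
Qed.

Lemma prime_dvd_radical N p : (0 < N)%N -> prime p ->
  (p %| radical N)%N = (p %| N)%N.
Proof.
move=> N0 pp; have -> : radical N = (\prod_(q <- primes N) q)%N.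
  by rewrite (big_nth 0%N) big_mkord.
rewrite Euclid_dvd_prod // big_has; apply/hasP/idP => [[q]|pN].
  by rewrite mem_primes => /and3P[qp _ qN]; rewrite dvdn_prime2 // => /eqP ->.
by exists p; rewrite ?dvdnn // mem_primes pp N0.
Qed.

Lemma radical_gt0 N : (0 < radical N)%N.
Proof. exact: pb_size_gt0. Qed.

(** At the diagonal point (i, ..., i) the weight is M^(-i), so a truncation of x gives floor(Y M^i)
    mod M on both sides. The radius from [microtile_tess] may depend on x; locality of
    [Conj_radical] follows from this identification with [convert]. *)
Lemma Conj_radicalE N (hN : (1 < N)%N) :
  Conj_radical hN = @convert N (radical N) (radical_gt0 N) (radical N).
Proof.
have N0 := ltnW hN.
have hA j : exists i, (0 < mult_mx N j i)%N.
  exists j; rewrite !mxE eqxx mulr1n logn_gt0 /nth_prime.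
  by rewrite mem_nth.
have [lC eC] : scales 1 (@convert N (radical N) (radical_gt0 N) (radical N)).
  apply: (@scales_convert _ _ _ _ N); apply: dvdn_exp_primes;
    rewrite ?radical_gt0 // => p pp; by rewrite prime_dvd_radical.
apply: funext => x; apply: funext => i; apply/val_inj.
pose x' := cast_config (primary_pb_size hN) x.
have [K hK] := microtile_tess (n := prime_pb N) (A := mult_mx N) x' (kvec i) hA.
have [L hL] := lC i.
have [y xy yY] := truncation (K + L) x; set Y := window_value _ _ in yY.
have [_ /(_ _ _ yY)] := scales_cast (primary_pb_size hN); rewrite mul1r => yY'.
have xyL : agree L x y by apply: agreeW xy; lia.
rewrite -/(symbol (convert _ _ x) i) (hL _ _ xyL).
have [_ _ cE] := eC _ _ yY; rewrite mul1r in cE; apply: etrans (esym (cE i)).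
transitivity (Num.truncn (Y / weight (prime_pb N) (kvec i)) %% radical N)%N.
  apply: hK yY' => j jK; rewrite /x' /cast_config /symbol; congr cast_ord.
  by apply: xy; lia.
by rewrite weight_kvec invr_expz opprK.
Qed.

Lemma scales_Conj_radical N (hN : (1 < N)%N) : exists G,
  [/\ scales 1 (Conj_radical hN), scales 1 G,
      cancel (Conj_radical hN) G & cancel G (Conj_radical hN)].
Proof.
have N0 := ltnW hN.
have NM : (N %| radical N ^ N)%N.
  by apply: dvdn_exp_primes => // p pp; rewrite prime_dvd_radical.
have MN : (radical N %| N ^ radical N)%N.
  apply: dvdn_exp_primes; first exact: radical_gt0.
  by move=> p pp; rewrite prime_dvd_radical.
exists (convert N0 N); rewrite Conj_radicalE.
have sF := scales_convert (radical_gt0 N) MN NM.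
have sG := scales_convert N0 NM MN.
have sGF := scales_comp sG sF; have sFG := scales_comp sF sG.
rewrite mulr1 in sGF sFG.
split=> // x.
  exact: (congr1 (@^~ x) (scales_unique sGF (@scales_id N))).
exact: (congr1 (@^~ x) (scales_unique sFG (@scales_id (radical N)))).
Qed.

(** As [Conj_radical] is bijective, [inverse_fun] is its true inverse and Conj is a composite of
    maps scaling by 1. Exchanging N and N' gives the inverse composite. *)
Lemma scales_Conj N N' (hN : (1 < N)%N) (hN' : (1 < N')%N)
    (same : same_primes N N') :
  exists G, [/\ scales 1 (Conj hN hN' same), scales 1 G,
    cancel (Conj hN hN' same) G & cancel G (Conj hN hN' same)].
Proof.
have [G [sF sG FG GF]] := scales_Conj_radical hN.
have [G' [sF' sG' FG' GF']] := scales_Conj_radical hN'.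
pose e := same_primes_radical hN hN' same.
have ConjE : Conj hN hN' same = G' \o (cast_config e \o Conj_radical hN).
  by apply: funext => x; apply: inverse_funE.
have sC : scales 1 (Conj hN hN' same).
  rewrite ConjE -[1]mulr1; apply: scales_comp sG' _.
  by rewrite -[1]mulr1; apply: scales_comp sF; apply: scales_cast.
have sI : scales 1 (G \o (cast_config (esym e) \o Conj_radical hN')).
  rewrite -[1]mulr1; apply: scales_comp sG _.
  by rewrite -[1]mulr1; apply: scales_comp sF'; apply: scales_cast.
have sCI := scales_comp sC sI; have sIC := scales_comp sI sC.
rewrite mulr1 in sCI sIC.
eexists; split; [exact: sC|exact: sI| |] => x.
  exact: (congr1 (@^~ x) (scales_unique sIC (@scales_id N))).
exact: (congr1 (@^~ x) (scales_unique sCI (@scales_id N'))).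
Qed.

(** * Topology of configuration spaces *)

Lemma nbhs_coordinate N (x : config N) (i : int) :
  nbhs x [set y | symbol x i = symbol y i].
Proof.
suff : nbhs (proj i x) [set a | symbol x i = a].
  exact: (@proj_continuous int (fun=> discrete_topology 'I_N) i x).
by rewrite nbhs_principalE; apply/principal_filterP.
Qed.

Lemma nbhs_configP N (x : config N) (A : set (config N)) :
  nbhs x A <-> exists K, [set y | agree K x y] `<=` A.
Proof.
split; last first.
  move=> [K KA]; apply: filterS KA _ => {A}; elim: K => [|K IH].
    apply: filterS (nbhs_coordinate x 0) => y /= xy i.
    by rewrite leqn0 absz_eq0 => /eqP ->.
  apply: filterS (filterI IH (filterI (nbhs_coordinate x K.+1%:Z)
    (nbhs_coordinate x (- K.+1%:Z)))) => y /= [xy [xy1 xy2]] i.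
  rewrite leq_eqVlt => /orP[/eqP iK|]; last exact: xy.
  by have [->|->] : i = K.+1%:Z \/ i = - K.+1%:Z by lia.
(* The supersets of the cylinders form a filter. It converges to x in each coordinate, hence in the
   product topology, so it contains every neighbourhood of x. *)
pose F : set_system (config N) := [set A | exists K, [set y | agree K x y] `<=` A].
have FF : Filter F.
  split; first by exists 0%N.
  - move=> P Q [K hK] [L hL]; exists (K + L)%N => y /= xy.
    by split; [apply: hK|apply: hL]; apply: agreeW xy; lia.
  - by move=> P Q PQ [K hK]; exists K; apply: subset_trans PQ.
suff : F --> x by apply.
apply/cvg_sup => i B; rewrite nbhsE => -[U [[V oV <-] Vx] UB].
by exists `|i|%N => y /= xy; apply: UB; rewrite /= -[y i](xy i).
Qed.

Lemma local_continuous N N' (F : config N -> config N') : local F -> continuous F.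
Proof.
move=> lF x A /nbhs_configP[K KA]; have [L hL] := local_agree lF K.
by apply/nbhs_configP; exists L => y /hL /KA.
Qed.

Lemma config_compact N : compact [set: config N].
Proof.
have cN : compact [set: discrete_topology 'I_N].
  by apply: finite_compact; apply: (@finite_finset 'I_N).
have := @tychonoff int (fun=> discrete_topology 'I_N) (fun=> setT)
  (fun=> cN).
rewrite (_ : [set f | _] = setT) //.
by apply/seteqP; split.
Qed.

Section Distance.
Variables (R : realType) (N : nat).
Implicit Types x y z : config N.

Lemma disagree_ex x y : x <> y -> exists K, `[< ~ agree K x y >].
Proof.
move=> xy; apply: contrapT => nK; apply: xy; apply: funext => i.
apply: contrapT => xyi; apply: nK; exists `|i|%N; apply/asboolP => h.
by apply: xyi; apply: h.
Qed.

(** An ultrametric: 1/(k+1) for the least radius k of disagreement, so that the open ball of radius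
    1/(K+1) is an [agree K] cylinder. *)
Definition dist x y : R :=
  if pselect (x = y) is right xy then (ex_minn (disagree_ex xy)).+1%:R^-1 else 0.

Lemma dist_lt x y K : dist x y < K.+1%:R^-1 <-> agree K x y.
Proof.
rewrite /dist; case: pselect => [<-|xy]; first by rewrite invr_gt0 ltr0n.
case: ex_minnP => k /asboolP nk mk; rewrite ltf_pV2 ?posrE ?ltr0n // ltr_nat ltnS.
split=> [Kk|aK]; last first.
  by rewrite ltnNge; apply/negP => kK; apply: nk; apply: agreeW aK.
by apply: contrapT => /asboolP /mk; rewrite leqNgt Kk.
Qed.

Lemma distxx x : dist x x = 0.
Proof. by rewrite /dist; case: pselect. Qed.

Lemma dist_neq x y : x <> y ->
  exists2 k, dist x y = k.+1%:R^-1 & ~ agree k x y.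
Proof.
rewrite /dist; case: pselect => // xy _.
by case: ex_minnP => k /asboolP nk _; exists k.
Qed.

Lemma dist_ge0 x y : 0 <= dist x y.
Proof. by rewrite /dist; case: pselect => // xy; rewrite invr_ge0 ler0n. Qed.

Lemma agree_sym K x y : agree K x y -> agree K y x.
Proof. by move=> h i /h. Qed.

Lemma dist_ge x y K : ~ agree K x y -> K.+1%:R^-1 <= dist x y.
Proof. by move=> nK; rewrite leNgt; apply/negP => /dist_lt. Qed.

Lemma dist_le_sym x y : dist x y <= dist y x.
Proof.
have [->|/dist_neq[k -> nk]] := pselect (x = y); first by rewrite lexx.
by apply: dist_ge => /agree_sym.
Qed.

Lemma config_metrizable : metrizable R (config N).
Proof.
exists dist; split.
- move=> x y; split=> [d0|->]; last exact: distxx.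
  apply: contrapT => /dist_neq[k dk _].
  by move: d0; rewrite dk => /eqP; rewrite invr_eq0 pnatr_eq0.
- by move=> x y; apply/le_anti; rewrite !dist_le_sym.
- move=> x y z; have [->|/dist_neq[k -> nk]] := pselect (x = z).
    by rewrite distxx addr_ge0 ?dist_ge0.
  (* Disagreement of x and z within radius k forces it for x, y or for y, z, so one of the two
     distances is already at least 1/(k+1). *)
  have [xy|nxy] := pselect (agree k x y).
    rewrite -[leLHS]add0r lerD ?dist_ge0 //; apply: dist_ge => yz.
    by apply: nk => i ik; rewrite xy // yz.
  by rewrite -[leLHS]addr0 lerD ?dist_ge0 //; apply: dist_ge.
move=> x A; rewrite nbhs_configP; split=> [[K KA]|[e e0 eA]].
  exists K.+1%:R^-1; first by rewrite invr_gt0 ltr0n.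
  by move=> y /dist_lt /KA.
exists (Num.truncn e^-1) => y /dist_lt xy; apply: eA => /=.
apply: lt_trans xy _; rewrite invf_plt ?posrE ?ltr0n //.
by apply: truncnS_gt.
Qed.

End Distance.

(** * Real values *)

Section RealValue.
Variable R : realType.

Definition central (K : nat) : set int :=
  [set` [seq j%:Z - K%:Z | j <- iota 0 (2 * K).+1]].

Lemma mem_central K (i : int) : (`|i| <= K)%N -> central K i.
Proof.
move=> iK; apply/mapP; exists (absz (i + K%:Z)); last by lia.
by rewrite mem_iota; lia.
Qed.

Lemma sum_central N (x : config N) K :
  (\sum_(i \in central K) ((symbol x (- i))%:R * N%:R ^ i : R)%R%:E)%E =
  (ratr (window_value K x) : R)%:E.
Proof.
have N0 := config_gt0 x.
rewrite -fsbig_seq; last by rewrite map_inj_uniq ?iota_uniq // => a b /=; lia.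
rewrite big_map sumEFin -[iota _ _]/(index_iota 0 (2 * K).+1) big_mkord; congr (_%:E).
rewrite /window_value fmorph_div /= rmorphXn /= !ratr_nat /window natr_sum mulr_suml.
apply: eq_bigr => j _; rewrite natrM natrX opprB -mulrA; congr (_ * _).
by rewrite expfzDr ?pnatr_eq0 -?lt0n // -exprnN.
Qed.

Lemma digit_value_ge0 N (x : config N) (i : int) :
  (0 <= ((symbol x (- i))%:R * N%:R ^ i : R)%R%:E)%E.
Proof. by rewrite lee_fin mulr_ge0 // exprz_ge0. Qed.

Lemma window_value_le_real N (x : config N) K :
  ((ratr (window_value K x) : R)%:E <= real_of_config R x)%E.
Proof.
apply: esum_ge; exists (central K); last by rewrite sum_central.
by split=> //; exact: finite_seq.
Qed.

Lemma finite_subset_central (A : set int) : finite_set A ->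
  exists K, A `<=` central K.
Proof.
move=> /finite_seqP[s ->]; exists (\sum_(i <- s) `|i|)%N => i /= si.
by apply: mem_central; rewrite (big_rem i) //= leq_addr.
Qed.

(** The terms are nonnegative and every finite index set lies in some [-K, K], so window values are
    cofinal among the finite partial sums. *)
Lemma real_of_config_le N (x : config N) (r : \bar R) :
  (forall K, ((ratr (window_value K x))%:E <= r)%E) -> (real_of_config R x <= r)%E.
Proof.
move=> h; apply: ge_ereal_sup => /= _ [A [finA _] <-].
have [K AK] := finite_subset_central finA.
apply: le_trans (h K); rewrite -sum_central.
apply: lee_fsum_nneg_subset => //; [exact: finite_seq|exact/subsetP|].
by move=> i _; apply: digit_value_ge0.
Qed.

Lemma scales1_real_le N N' (F : config N -> config N') x :
  scales 1 F -> (real_of_config R (F x) <= real_of_config R x)%E.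
Proof.
move=> [lF eF]; apply: real_of_config_le => K.
(* The truncation y has value [window_value L x], and its image has the same K-window as F x. *)
have [L hL] := local_agree lF K; have [y xy /eF yY] := truncation L x.
apply: le_trans (window_value_le_real x L); rewrite lee_fin ler_rat.
have := window_value_le K yY; rewrite mul1r; apply: le_trans.
rewrite /window_value (eq_window (hL _ _ xy)) //; lia.
Qed.

End RealValue.

Lemma scales_dynamical_system (R : realType) N a (F : config N -> config N) :
  scales a F -> dynamical_system R F.
Proof.
move=> [lF _].
by split; [exact: config_compact|exact: config_metrizable|exact: local_continuous].
Qed.

Theorem corollary5p10 (R : realType) (N1 N2 : nat)
    (h1 : (1 < N1)%N) (h2 : (1 < N2)%N) (same : same_primes N1 N2) :
  (forall alpha : rat, 0 < alpha ->
     Pi_defined alpha N1 -> Pi_defined alpha N2 ->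
     conjugate_via R (Pi alpha N1) (Pi alpha N2) (Conj h1 h2 same)) /\
  @real_of_config R N2 \o Conj h1 h2 same = @real_of_config R N1.
Proof.
have [G [sC sG CG GC]] := scales_Conj h1 h2 same; split.
  move=> alpha _ d1 d2.
  have s1 := scales_Pi (ltnW h1) d1; have s2 := scales_Pi (ltnW h2) d2.
  split.
  - exact: scales_dynamical_system s1.
  - exact: scales_dynamical_system s2.
  - by apply: local_continuous; case: sC.
  - by exists G.
  - have := scales_comp sC s1; have := scales_comp s2 sC.
    by rewrite mulr1 mul1r => e2 e1; apply: scales_unique e1 e2.
apply: funext => x /=; apply/le_anti; rewrite scales1_real_le //=.
(* The reverse inequality applies the same bound to the inverse [G]. *)
by rewrite -{1}(CG x) scales1_real_le.
Qed.
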